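(* Let $X$ be a Banach space over $\mathbb{K}$ with $\dim(X)\geq 2$. Then the pair $(X,\ell_\infty^2)$ fails property $\mathbf{L}_{o,p}$.
   Context: Banach spaces are over $\mathbb{K}$, which is $\mathbb{R}$ or $\mathbb{C}$. $\ell_\infty^2$ denotes $\mathbb{K}^2$ with the maximum norm. $S_X$ denotes the unit sphere of $X$, and $\mathcal{L}(X,Y)$ the space of bounded linear operators from $X$ to $Y$ with the operator norm. A pair $(X,Y)$ of Banach spaces has property $\mathbf{L}_{o,p}$ if for every $\varepsilon>0$ and every $x\in S_X$ there is $\eta(\varepsilon,x)>0$ such that whenever $T\in\mathcal{L}(X,Y)$ with $\|T\|=1$ satisfies $\|T(x)\|>1-\eta(\varepsilon,x)$, there is $x_0\in S_X$ with $\|T(x_0)\|=1$ and $\|x_0-x\|<\varepsilon$. *)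

(* Defs.v *)
From HB Require Import structures.
From mathcomp Require Import all_boot all_order all_algebra.
From mathcomp Require Import complex.
From mathcomp Require Import all_classical all_reals all_analysis.

Set Implicit Arguments.
Unset Strict Implicit.
Unset Printing Implicit Defensive.

Import Order.TTheory GRing.Theory Num.Theory.
Import numFieldNormedType.Exports.

Local Open Scope classical_set_scope.
Local Open Scope ring_scope.

(* The scalar field K is a numFieldType so that the real and the complex case
   share their definitions. Norms take their values in K; when K = R[i],
   a <= b means that b - a is a nonnegative real, so that 0 < e says that e is
   a positive real, and suprema of norms are taken for this partial order. *)

Definition unit_sphere (K : numFieldType) (X : normedModType K) : set X :=
  [set x | `|x| = 1].
Arguments unit_sphere {K} X.

(* No upper bound on the dimension: X may be infinite dimensional. *)
Definition dim_at_least (K : numFieldType) (n : nat) (X : lmodType K) : Prop :=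
  exists v : 'I_n -> X,
    forall c : 'I_n -> K, \sum_(i < n) c i *: v i = 0 -> forall i, c i = 0.

Definition bounded_operator (K : numFieldType) (X Y : normedModType K)
  (T : {linear X -> Y}) : Prop := bounded_near T (nbhs (0 : X)).

(* The default value 0 is never used when K is R or R[i] and T is bounded. *)
Definition opnorm (K : numFieldType) (X Y : normedModType K)
  (T : {linear X -> Y}) : K :=
  supremum 0 [set `|T x| | x in [set x : X | `|x| <= 1]].

Definition property_Lop (K : numFieldType) (X Y : normedModType K) : Prop :=
  forall (e : K) (x : X), 0 < e -> unit_sphere X x ->
  exists2 eta : K, 0 < eta &
    forall T : {linear X -> Y}, bounded_operator T -> opnorm T = 1 ->
      1 - eta < `|T x| ->
      exists x0 : X, [/\ unit_sphere X x0, `|T x0| = 1 & `|x0 - x| < e].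

(* The library norm on row vectors is the maximum of the moduli of the
   entries. *)
Definition linfty2 (K : numFieldType) : normedModType K := 'rV[K]_2.

(* Main.v *)
Require Import Defs.
From HB Require Import structures.
From mathcomp Require Import all_boot all_order all_algebra.
From mathcomp Require Import complex.
From mathcomp Require Import ring lra.
From mathcomp Require Import all_classical all_reals all_analysis.
(** The property fails because the norm of an operator into the plane may be
    reached by one coordinate only, while at a given point x that coordinate
    vanishes and the other one is close to 1.  Pick a unit vector y, a
    functional f with f y = 1 and norm 1, and a unit vector x in the kernel of
    f; the kernel is nonzero because X has dimension at least 2.  Pick also a
    functional g with g x = 1 and norm 1.  For 0 < c < 1 the operator
    T z = (f z, c * g z) has norm 1, attained at y, while |T x| = c can be made
    larger than 1 - eta.  Yet |T x0| = 1 is impossible when |x0 - x| < 1 and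
    |x0| = 1: the first coordinate is |f x0| = |f (x0 - x)| < 1, and the second
    has modulus at most c.  Hence no eta serves for this x and epsilon = 1; this
    is [not_property_Lop], valid over any scalar field for which every vector
    has a norming functional.

    Norming functionals come from the Hahn-Banach theorem, proved here in the
    form [Hahn_Banach_sublinear]: a sublinear p on a real vector space dominates
    a linear functional that agrees with p at a chosen point.  Instead of
    extending functionals from subspaces, the proof takes by Zorn's lemma a
    minimal sublinear function below p.  Such a function is odd, because
    [sublinear_lower] pushes any sublinear q down to a sublinear function with
    value at most - q y at - y, and an odd sublinear function is linear.  The
    same push at the chosen point secures the equality there.

    Over the complex numbers the theorem is applied to the underlying real
    space; z |-> f z - i f (i z) is then complex linear, and multiplying z by
    a scalar of modulus 1 shows that it has the same bound as f. *)

Set Implicit Arguments.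
Unset Strict Implicit.
Unset Printing Implicit Defensive.

Import Order.TTheory GRing.Theory Num.Theory.
Import numFieldNormedType.Exports.

Local Open Scope classical_set_scope.
Local Open Scope ring_scope.
Local Open Scope complex_scope.

(** * Sublinear functions and the Hahn-Banach theorem *)

Section Sublinear.
Context {R : realType} {V : lmodType R}.
Implicit Types (p q : V -> R) (F : set (V -> R)) (x y : V).

(** Only the inequality that survives pointwise infima is required of the
    scaling; applied to a and to its inverse it gives positive homogeneity. *)
Definition sublinear p :=
  (forall x y, p (x + y) <= p x + p y) /\
  (forall a x, 0 < a -> a * p x <= p (a *: x)).

Lemma sublinear0 p : sublinear p -> p 0 = 0.
Proof.
move=> [pD pZ]; have := pD 0 0; have := pZ 2 0; rewrite scaler0 addr0.
by move=> /(_ (ltr0n _ 2)); lra.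
Qed.

Lemma sublinear_ge_opp p x : sublinear p -> - p (- x) <= p x.
Proof.
by move=> sp; have := sp.1 x (- x); rewrite subrr sublinear0//; lra.
Qed.

Definition inf_fun F x : R := inf [set q x | q in F].

Lemma inf_fun_le F x (q : V -> R) b :
  (forall q, F q -> b <= q x) -> F q -> inf_fun F x <= q x.
Proof.
move=> Fb Fq; apply: ge_inf; last by exists q.
by exists b => _ [r Fr <-]; exact: Fb.
Qed.

Lemma le_inf_fun F x b :
  F !=set0 -> (forall q, F q -> b <= q x) -> b <= inf_fun F x.
Proof.
move=> [q Fq] Fb; apply: lb_le_inf; first by exists (q x), q.
by move=> _ [r Fr <-]; exact: Fb.
Qed.

(** The inequality for the infimum at x + y compares q x + r y, with two different
    members of F, to a third member; this lets F be a chain, where the smaller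
    of q and r serves, or a family of shifts, where the parameters add up.  The
    lower bound b keeps the infimum from taking its default value. *)
Lemma sublinear_inf_fun F (b : V -> R) :
  F !=set0 -> (forall q x, F q -> b x <= q x) ->
  (forall q r x y, F q -> F r -> exists2 s, F s & s (x + y) <= q x + r y) ->
  (forall q a x, F q -> 0 < a -> exists2 s, F s & a * s x <= q (a *: x)) ->
  sublinear (inf_fun F).
Proof.
move=> F0 Fb FD FZ; split=> [x y|a x a0].
- rewrite -lerBlDr; apply: le_inf_fun => // q Fq.
  rewrite lerBlDr -lerBlDl; apply: le_inf_fun => // r Fr.
  have [s Fs] := FD _ _ x y Fq Fr; rewrite lerBlDl; apply: le_trans.
  exact: (inf_fun_le (fun t => Fb t (x + y))).
- apply: le_inf_fun => // q Fq; have [s Fs] := FZ _ _ x Fq a0.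
  apply: le_trans; rewrite ler_pM2l//.
  exact: (inf_fun_le (fun t => Fb t x)).
Qed.

(** The infimum over t >= 0 of p (x + t y) - t p y is below p (take t = 0), and
    at x = - y the choice t = 1 gives - p y.  It is bounded below by - p (- x)
    because t p y <= p (t y) <= p (x + t y) + p (- x). *)
Lemma sublinear_lower p y : sublinear p ->
  exists q, [/\ sublinear q, forall x, q x <= p x & q (- y) <= - p y].
Proof.
move=> sp; have [pD pZ] := sp.
have p0 := sublinear0 sp.
pose shift t x := p (x + t *: y) - t * p y.
pose F := [set shift t | t in [set t | 0 <= t]].
have Fb q x : F q -> - p (- x) <= q x.
  move=> [t /= t0 <-]; rewrite /shift.
  have tp : t * p y <= p (t *: y).
    move: t0; rewrite le_eqVlt => /predU1P[<-|t0]; last exact: pZ.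
    by rewrite scale0r p0 mul0r.
  have := pD (x + t *: y) (- x); rewrite addrAC subrr add0r; lra.
have F0 : F !=set0 by exists (shift 0), 0 => /=.
have Fle t x : 0 <= t -> inf_fun F x <= shift t x.
  by move=> t0; apply: (inf_fun_le (fun q => Fb q x)); exists t.
exists (inf_fun F); split.
- apply: (sublinear_inf_fun (b := fun x => - p (- x))) => //.
  + move=> _ _ x z [s /= s0 <-] [t /= t0 <-].
    exists (shift (s + t)); first by exists (s + t) => //=; exact: addr_ge0.
    rewrite /shift scalerDl addrACA.
    have := pD (x + s *: y) (z + t *: y); lra.
  + move=> _ a x [t /= t0 <-] a0.
    exists (shift (t / a)).
      by exists (t / a) => //=; rewrite divr_ge0// ltW.
    rewrite /shift.
    have -> : a *: x + t *: y = a *: (x + (t / a) *: y).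
      by rewrite scalerDr scalerA mulrCA divff ?mulr1 ?gt_eqF.
    have -> : a * (p (x + (t / a) *: y) - t / a * p y) =
              a * p (x + (t / a) *: y) - t * p y by field; rewrite gt_eqF.
    by rewrite lerB// pZ.
- move=> x; have := Fle 0 x (lexx 0).
  by rewrite /shift scale0r addr0 mul0r subr0.
- have := Fle 1 (- y) ler01.
  by rewrite /shift scale1r addNr p0 mul1r sub0r.
Qed.

(** Zorn's lemma for the reverse pointwise order.  A chain below p has a
    pointwise infimum, since each of its members is at least - p (- x) at x. *)
Lemma sublinear_minimal p : sublinear p ->
  exists q, [/\ sublinear q, forall x, q x <= p x &
    forall r, sublinear r -> (forall x, r x <= q x) -> forall x, q x <= r x].
Proof.
move=> sp.
pose T := {q : V -> R | sublinear q /\ forall x, q x <= p x}.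
pose below (q r : T) := `[< forall x, sval r x <= sval q x >].
have pT : sublinear p /\ forall x, p x <= p x by [].
have [||A Atot|[q [sq qp]] qmin] := @ZL_preorder T (exist _ p pT) below.
- by move=> q; apply/asboolP.
- move=> r q s /asboolP qr /asboolP sq; apply/asboolP => x.
  exact: le_trans (sq x) (qr x).
- have [[r0 Ar0]|A0] := pselect (exists r, A r); last first.
    by exists (exist _ p pT) => s As; case: A0; exists s.
  pose F := [set sval r | r in A].
  have Fb q x : F q -> - p (- x) <= q x.
    move=> [[r [sr rp]] _ <-] /=; have := sublinear_ge_opp x sr.
    by have := rp (- x); lra.
  have F0 : F !=set0 by exists (sval r0), r0.
  have Fle x r : A r -> inf_fun F x <= sval r x.
    by move=> Ar; apply: (inf_fun_le (fun q => Fb q x)); exists r.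
  have sF : sublinear (inf_fun F).
    apply: (sublinear_inf_fun (b := fun x => - p (- x))) => //.
    + move=> _ _ x y [q Aq <-] [r Ar <-].
      (* of two members of a chain, the smaller one works *)
      have [/asboolP h|/asboolP h] := Atot _ _ Aq Ar.
      * exists (sval r); first by exists r.
        have := (svalP r).1.1 x y; have := h x; lra.
      * exists (sval q); first by exists q.
        have := (svalP q).1.1 x y; have := h y; lra.
    + move=> _ a x [q Aq <-] a0; exists (sval q); first by exists q.
      exact: (svalP q).1.2.
  have Fp x : inf_fun F x <= p x.
    exact: le_trans (Fle x r0 Ar0) ((svalP r0).2 x).
  exists (exist _ (inf_fun F) (conj sF Fp) : T) => s As; apply/asboolP => x /=.
  exact: Fle.
- exists q; split=> // r sr rq x.
  have rp z : r z <= p z by exact: le_trans (rq z) (qp z).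
  have /= := qmin (exist _ r (conj sr rp) : T).
  by move=> /(_ (asboolT rq))/asboolP; apply.
Qed.

(** By minimality q equals its own lowering at y, so q (- y) = - q y.  Oddness
    then reverses the inequalities of sublinearity. *)
Lemma minimal_sublinear_linear q : sublinear q ->
  (forall r, sublinear r -> (forall x, r x <= q x) -> forall x, q x <= r x) ->
  scalar q.
Proof.
move=> sq qmin; have [qD qZ] := sq.
have qN y : q (- y) = - q y.
  have [r [sr rq ry]] := sublinear_lower y sq.
  have := qmin _ sr rq (- y); have := sublinear_ge_opp (- y) sq.
  by rewrite opprK => ? ?; apply/eqP; rewrite eq_le; apply/andP; split; lra.
have qDE x y : q (x + y) = q x + q y.
  apply/eqP; rewrite eq_le qD /=.
  by have := qD (x + y) (- y); rewrite addrK qN; lra.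
have qpZ a x : 0 < a -> q (a *: x) = a * q x.
  move=> a0; apply/eqP; rewrite eq_le qZ// andbT.
  by have := qZ a (- x) a0; rewrite scalerN !qN; lra.
move=> a x y; rewrite qDE; congr (_ + _).
have [a0|a0|->] := ltgtP a 0.
- by rewrite -{1}[a]opprK scaleNr qN qpZ ?oppr_gt0 // mulNr opprK.
- exact: qpZ.
- by rewrite scale0r mul0r sublinear0.
Qed.

(** The lowering r of p at x is what forces f x = p x: a linear f below r has
    - f x = f (- x) <= r (- x) <= - p x. *)
Lemma Hahn_Banach_sublinear p x : sublinear p ->
  exists f : {scalar V}, f x = p x /\ forall y, f y <= p y.
Proof.
move=> sp.
have [r [sr rp rx]] := sublinear_lower x sp.
have [q [sq qr qmin]] := sublinear_minimal sr.
have lq := minimal_sublinear_linear sq qmin.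
pose qL := GRing.isLinear.Build R V R *%R q lq.
pose f : {scalar V} := HB.pack q qL.
exists f; split=> [|y]; last exact: le_trans (qr y) (rp y).
apply/eqP; rewrite eq_le (le_trans (qr x) (rp x))/=.
have : f (- x) <= - p x by exact: le_trans (qr (- x)) rx.
by rewrite linearN lerN2.
Qed.

End Sublinear.

(** * Norming functionals *)

Definition has_norming_functionals (K : numFieldType) (X : normedModType K) :=
  forall x : X, exists f : {scalar X},
    f x = `|x| /\ forall y, `|f y| <= `|y|.

Lemma norming_functionals_real (R : realType) (X : normedModType R) :
  has_norming_functionals X.
Proof.
move=> x.
have sp : sublinear (fun y : X => `|y|).
  split=> [y z|a y a0]; first exact: ler_normD.
  by rewrite normrZ gtr0_norm.
have [f [fx fle]] := Hahn_Banach_sublinear x sp.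
exists f; split=> // y; rewrite ler_norml fle andbT.
by have := fle (- y); rewrite linearN normrN; lra.
Qed.

(** A separate name for the carrier of X, so that the real module structure does
    not compete with the complex one. *)
Definition restrict_scalars (R : realType) (X : lmodType R[i]) : Type := X.

Section RestrictScalars.
Variables (R : realType) (X : lmodType R[i]).
Local Notation XR := (restrict_scalars X).

HB.instance Definition _ := GRing.Zmodule.copy XR X.

Definition real_scale (a : R) (x : XR) : XR := a%:C *: (x : X).

Fact real_scaleA a b x : real_scale a (real_scale b x) = real_scale (a * b) x.
Proof. by rewrite /real_scale scalerA -rmorphM. Qed.
Fact real_scale1 : left_id 1 real_scale.
Proof. by move=> x; rewrite /real_scale rmorph1 scale1r. Qed.
Fact real_scaleDr : right_distributive real_scale +%R.
Proof. by move=> a x y; rewrite /real_scale scalerDr. Qed.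
Fact real_scaleDl x : {morph real_scale^~ x : a b / a + b}.
Proof. by move=> a b; rewrite /real_scale rmorphD scalerDl. Qed.

HB.instance Definition _ := GRing.Zmodule_isLmodule.Build R XR
  real_scaleA real_scale1 real_scaleDr real_scaleDl.

End RestrictScalars.

Section Complexify.
Variables (R : realType) (X : lmodType R[i]).
Variable f : {scalar restrict_scalars X}.

(** The only complex linear functional with real part f. *)
Definition complexify (x : X) : R[i] := f x +i* - f ('i *: x).

Lemma complexify_is_scalar : scalar complexify.
Proof.
have fZ (a : R) (x : X) : f (a%:C *: x) = a * f x by exact: (scalarZ f).
have fD (x y : X) : f (x + y) = f x + f y by exact: (linearD f).
move=> [a b] x y; rewrite /complexify.
have -> : (a +i* b) *: x = a%:C *: x + b%:C *: ('i *: x).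
  by rewrite scalerA -scalerDl; congr (_ *: _); simpc.
have -> : 'i *: (a%:C *: x + b%:C *: ('i *: x) + y) =
          a%:C *: ('i *: x) + (- b)%:C *: x + 'i *: y.
  rewrite !scalerDr !scalerA; congr (_ *: _ + _ *: _ + _); simpc; first by [].
  by rewrite complexr0.
rewrite !fD !fZ; simpc; congr (_ +i* _); ring.
Qed.

HB.instance Definition _ :=
  GRing.isLinear.Build R[i] X R[i] *%R complexify complexify_is_scalar.

Lemma Re_complexify x : complex.Re (complexify x) = f x.
Proof. by []. Qed.

End Complexify.

Lemma norm_Re_eq (R : realType) (z : R[i]) (r : R) :
  complex.Re z = r -> `|z| <= r%:C -> z = r%:C.
Proof.
case: z => a b /= ->; rewrite normc_def lecR /= => h.
have r0 : 0 <= r by exact: le_trans (sqrtr_ge0 _) h.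
have : b ^+ 2 <= 0.
  rewrite -(lerD2l (r ^+ 2)) addr0 -ler_sqrt ?sqr_ge0//.
  by rewrite sqrtr_sqr ger0_norm.
by rewrite le_eqVlt ltNge sqr_ge0 orbF sqrf_eq0 => /eqP->.
Qed.

(** Let u have modulus 1 with u * F y = |F y|, where F is the complexification
    of f.  Then F (u y) is real, hence equal to f (u y), which is at most
    |u y| = |y|. *)
Lemma norming_functionals_complex (R : realType) (X : normedModType R[i]) :
  has_norming_functionals X.
Proof.
move=> x; pose XR := restrict_scalars X.
have Re_norm (y : X) : (complex.Re `|y|)%:C = `|y| by rewrite RRe_real.
pose N : XR -> R := fun y => complex.Re `|y : X|.
have sN : sublinear N.
  split=> [y z|a y a0].
  - by rewrite -lecR rmorphD /= !Re_norm ler_normD.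
  - rewrite -lecR rmorphM /= !Re_norm [leRHS]normrZ.
    by rewrite ger0_norm // ler0c ltW.
have [f [fx fN]] := Hahn_Banach_sublinear (x : XR) sN.
have le_norm (y : X) : `|complexify f y| <= `|y|.
  have [->|Fy0] := eqVneq (complexify f y) 0; first by rewrite normr0.
  pose u := `|complexify f y| / complexify f y.
  have u1 : `|u| = 1 by rewrite normf_div normr_id divff ?normr_eq0.
  have Fu : complexify f (u *: y) = `|complexify f y|.
    by rewrite linearZ_LR /= divfK.
  rewrite -Fu -(RRe_real (x := complexify f (u *: y))); last first.
    by rewrite Fu normr_real.
  rewrite Re_complexify -[leRHS]mul1r -u1 -normrZ -Re_norm lecR.
  exact: fN.
exists (complexify f); split=> //.
rewrite -Re_norm; apply: norm_Re_eq; last by rewrite Re_norm; exact: le_norm.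
by rewrite Re_complexify fx.
Qed.

(** * Operators into the plane with the maximum norm *)

Section RowOperator.
Variables (K : numFieldType) (X : normedModType K) (f g : {scalar X}).

Definition row_operator (x : X) : linfty2 K :=
  \row_(j < 2) if j == 0 then f x else g x.

Lemma row_operator_is_linear : linear row_operator.
Proof.
by move=> a x y; apply/rowP => j; rewrite !mxE; case: ifP => _; rewrite linearP.
Qed.

HB.instance Definition _ :=
  GRing.isLinear.Build K X (linfty2 K) *:%R row_operator row_operator_is_linear.

End RowOperator.

Lemma norm_row_entry (K : numFieldType) n (u : 'rV[K]_n) j : `|u 0 j| <= `|u|.
Proof.
rewrite [leRHS]/Num.Def.normr /= mx_normE -[leLHS]nngE num_le.
exact: (le_bigmax _ (fun ij : 'I_1 * 'I_n => `|u ij.1 ij.2|%:nng) (0, j)).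
Qed.

(** The alternative [`|u| = 0] covers rows without entries. *)
Lemma norm_row_attained (K : numFieldType) n (u : 'rV[K]_n) :
  `|u| = 0 \/ exists j, `|u| = `|u 0 j|.
Proof.
have [|/mx_norm_neq0[[i j] h]] := eqVneq `|u| 0; first by left.
by right; exists j; rewrite -(ord1 i).
Qed.

(** In a general K a supremum may fail to exist; a maximum always is one, and
    it is the only one by antisymmetry. *)
Lemma opnorm_attained (K : numFieldType) (X Y : normedModType K)
    (T : {linear X -> Y}) (y : X) :
  `|y| <= 1 -> (forall x, `|x| <= 1 -> `|T x| <= `|T y|) ->
  opnorm T = `|T y|.
Proof.
move=> y1 Ty; rewrite /opnorm /supremum ifF; last first.
  by apply/eqP => /seteqP[+ _] => /(_ `|T y|); apply; exists y.
apply: (xget_unique _ _).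
- split; first by move=> _ [x /= x1 <-]; exact: Ty.
  by move=> b; apply; exists y.
- move=> b sb; apply: is_subset1_supremums sb _.
  split; first by move=> _ [x /= x1 <-]; exact: Ty.
  by move=> c; apply; exists y.
Qed.

(** * Failure of the property *)

Lemma unit_kernel_vector (K : numFieldType) (X : normedModType K)
    (f : {scalar X}) :
  dim_at_least 2 X -> exists2 x : X, `|x| = 1 & f x = 0.
Proof.
move=> [v vfree].
suff [z z0 fz] : exists2 z : X, z != 0 & f z = 0.
  exists (`|z|^-1 *: z).
    by rewrite normrZ normfV normr_id mulVf ?normr_eq0.
  by rewrite linearZ_LR /= fz mulr0.
pose v0 := v ord0; pose v1 := v (lift ord0 ord0).
have free2 a b : a *: v0 + b *: v1 = 0 -> a = 0 /\ b = 0.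
  move=> ab0; have := vfree (fun i => if i == ord0 then a else b).
  rewrite big_ord_recl big_ord1 /= => /(_ ab0) c0.
  by split; [exact: (c0 ord0)|exact: (c0 (lift ord0 ord0))].
have [f0|f0] := eqVneq (f v0) 0.
- exists v0 => //; apply/eqP => v00.
  have [] := free2 1 0; last by move/eqP; rewrite oner_eq0.
  by rewrite scale0r addr0 scale1r.
- exists (f v1 *: v0 + (- f v0) *: v1).
    by apply: contra f0 => /eqP/free2[_ /eqP]; rewrite oppr_eq0.
  by rewrite linearD !linearZ_LR /= mulNr mulrC subrr.
Qed.

Lemma not_property_Lop (K : numFieldType) (X : normedModType K) :
  has_norming_functionals X -> dim_at_least 2 X ->
  ~ property_Lop X (linfty2 K).
Proof.
move=> norming dimX Lop.
(* h is an arbitrary functional: it only serves to produce a unit vector *)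
have [h _] := norming 0.
have [y y1 _] := unit_kernel_vector h dimX.
have [f [fy fle]] := norming y.
have [x x1 fx] := unit_kernel_vector f dimX.
have [g [gx gle]] := norming x.
have [eta eta0 attain] := Lop 1 x ltr01 x1.
(* this c satisfies 1 - eta < c < 1 because (1 - eta) (1 + eta) < 1 *)
pose c : K := (1 + eta)^-1.
have eta1 : 0 < 1 + eta by rewrite addr_gt0.
have c0 : 0 < c by rewrite invr_gt0.
have c1 : c < 1 by rewrite invf_lt1 // ltrDl.
have etac : 1 - eta < c.
  rewrite -[c]mul1r ltr_pdivlMr // mulrBl !mul1r mulrDr mulr1 opprD addrA.
  by rewrite addrK gtrDl oppr_lt0 mulr_gt0.
pose T : {linear X -> linfty2 K} := row_operator f (c \*o g).
have T0 z : T z 0 0 = f z by rewrite !mxE.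
have T1 z : T z 0 1 = c * g z by rewrite !mxE.
have TE z : `|T z| = 0 \/ `|T z| = `|f z| \/ `|T z| = c * `|g z|.
  have [|[j ->]] := norm_row_attained (T z); first by left.
  right; have [->|->] : j = 0 \/ j = 1.
  + by case: j => -[|[|//]] j2; [left|right]; apply: val_inj.
  + by left; rewrite T0.
  + by right; rewrite T1 normrM gtr0_norm.
have Tle z : `|T z| <= `|z|.
  have [->//|[->//|->]] := TE z.
  by rewrite (le_trans _ (gle z)) // ler_piMl // ltW.
have Ty : `|T y| = 1.
  apply/eqP; rewrite eq_le -{1}y1 Tle /=.
  by have := norm_row_entry (T y) 0; rewrite T0 fy normr_id y1.
have Tbounded : bounded_operator T.
  apply/linear_boundedP; exists 1; split; first exact: real1.
  by move=> r r1 z; rewrite (le_trans (Tle z)) // ler_peMl // ltW.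
have Tnorm : opnorm T = 1.
  rewrite -Ty; apply: opnorm_attained; first by rewrite y1.
  by move=> z z1; rewrite Ty (le_trans (Tle z)).
have Tx : 1 - eta < `|T x|.
  apply: lt_le_trans etac _.
  have := norm_row_entry (T x) 1.
  by rewrite T1 gx x1 mulr1 gtr0_norm.
have [x0 [x01 Tx0 x0x]] := attain T Tbounded Tnorm Tx.
suff : `|T x0| < 1 by rewrite Tx0 ltxx.
have [->//|[->|->]] := TE x0.
- have -> : f x0 = f (x0 - x) by rewrite linearB /= fx subr0.
  exact: le_lt_trans (fle _) x0x.
- apply: le_lt_trans c1; rewrite ler_piMr ?(ltW c0) //.
  by rewrite (le_trans (gle x0)) // x01.
Qed.

Theorem proposition2p7 (R : realType) :
  (forall X : completeNormedModType R,
     dim_at_least 2 X -> ~ property_Lop X (linfty2 R)) /\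
  (forall X : completeNormedModType R[i],
     dim_at_least 2 X -> ~ property_Lop X (linfty2 R[i])).
Proof.
split=> X; apply: not_property_Lop.
- exact: norming_functionals_real.
- exact: norming_functionals_complex.
Qed.
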